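(* Let $a,b,c\in\mathbb C$ with $c\notin\mathbb Z$ and $c\ne b+1$. Then, as power series in $t$, $$F(a,b,c;t)\,F(-a,-b-2,-c;t)+\frac{a\,(b)_3\,(a-c)}{c\,(c-1)_3\,(c-b-1)}\,t^2\,F(a-c+1,b-c+1,2-c;t)\,F(-a+c+1,-b+c-1,2+c;t)$$ $$=1-\frac{2a}{c}\,t+\frac{a(a-b-1)}{c(c-b-1)}\,t^2 .$$
   Context: $F(a,b,c;t)={}_2F_1(a,b,c;t)=\sum_{n\ge0}\frac{(a)_n(b)_n}{n!\,(c)_n}t^n$ is the Gauss hypergeometric series, with $(a)_n=a(a+1)\cdots(a+n-1)$. *)

(* Defs.v *)
From mathcomp Require Import all_boot all_order all_algebra.

Set Implicit Arguments.
Unset Strict Implicit.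
Unset Printing Implicit Defensive.

Import Order.TTheory GRing.Theory Num.Theory.
Local Open Scope ring_scope.

(* Formal power series in one variable t: f n is the coefficient of t^n,
   and equality is coefficientwise, f =1 g. *)
Definition fps (K : Type) : Type := nat -> K.

Definition fps_of_poly (K : nzRingType) (p : {poly K}) : fps K :=
  fun n => p`_n.

Arguments fps_of_poly {K} p%_ring_scope.

Definition fps_add (K : nzRingType) (f g : fps K) : fps K :=
  fun n => f n + g n.

Definition fps_mul (K : nzRingType) (f g : fps K) : fps K :=
  fun n => \sum_(i < n.+1) f i * g (n - i)%N.

Declare Scope fps_scope.
Delimit Scope fps_scope with fps.
Notation "f * g" := (fps_mul f g) : fps_scope.
Notation "f + g" := (fps_add f g) : fps_scope.

Definition pochhammer (K : nzRingType) (x : K) (n : nat) : K :=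
  \prod_(i < n) (x + i%:R).

(* Meaningful only when c is not a nonpositive integer, since 0^-1 = 0. *)
Definition hyp2F1 (K : fieldType) (a b c : K) : fps K :=
  fun n => (pochhammer a n * pochhammer b n) / (n`!%:R * pochhammer c n).

Arguments hyp2F1 {K} (a b c)%_ring_scope.

(* Main.v *)
Require Import Defs.
From mathcomp Require Import all_boot all_order all_algebra.
From mathcomp Require Import reals complex.
From mathcomp Require Import ring.
Import Order.TTheory GRing.Theory Num.Theory.
Local Open Scope ring_scope.

(** The two products on the left are [y1 z1] and, up to a constant, [y2 z2],
    where [y1 = F(a,b,c)] and [y2 = t^(1-c) F(a-c+1,b-c+1,2-c)] are the
    solutions at [t = 0] of the hypergeometric equation [E(a,b,c)], and [z1]
    and [z2 = t^(1+c) F(-a+c+1,-b+c-1,2+c)] are those of [E(-a,-b-2,-c)]; the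
    fractional exponents cancel to leave [t^2].  Writing [theta = t d/dt], for
    every solution [y] of the first equation and [z] of the second the four
    functions [y z], [y theta(z)], [theta(y) z], [theta(y) theta(z)] satisfy one
    and the same first-order linear system (Leibniz rule plus the two
    equations), hence so does their combination [y1 z1 + k y2 z2].

    Read on coefficients, the system expresses the coefficients of [t^N] through
    those of [t^(N-1)] as long as [N] is not an exponent at the origin; the
    exponents are [0], [2], [1-c] and [1+c], and [c] is not an integer, so for
    [N > 2] the recursion determines everything ([product_systemS]).  The
    constant [k] is the one for which the coefficients of [t^2] contribute
    nothing to those of [t^3] ([no_source_hyp]).  Then all coefficients from
    [t^3] on vanish ([product_system_eq0]) and the sum is the quadratic
    polynomial formed by its first three coefficients, which are computed
    directly. *)

(** * Coefficients of products of Frobenius series *)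

Section Moments.
Set Implicit Arguments.
Unset Strict Implicit.
Variable K : comNzRingType.
Implicit Types (f g : fps K) (a b c rho sigma : K).

(** This says that [t^rho * f(t)] solves the hypergeometric equation
    [theta (theta + c - 1) y = t (theta + a) (theta + b) y]. *)
Definition frobenius_sol a b c rho f : Prop :=
  rho * (rho + c - 1) = 0 /\
  forall n, (rho + n.+1%:R) * (rho + n.+1%:R + c - 1) * f n.+1
            = (rho + n%:R + a) * (rho + n%:R + b) * f n.

(** The coefficient of [t^(rho + sigma + n)] in
    [theta^p (t^rho f) * theta^q (t^sigma g)]. *)
Definition moment rho sigma f g (p q n : nat) : K :=
  \sum_(i < n.+1) (rho + i%:R) ^+ p * (sigma + (n - i)%N%:R) ^+ q
                  * (f i * g (n - i)%N).

Lemma moment_sym rho sigma f g p q n :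
  moment rho sigma f g p q n = moment sigma rho g f q p n.
Proof.
rewrite /moment (reindex_inj rev_ord_inj) /=; apply: eq_bigr => i _.
by rewrite subSS subKn -1?ltnS // [_ ^+ p * _]mulrC [f _ * _]mulrC.
Qed.

(** The Leibniz rule for [theta]. *)
Lemma moment_leibniz rho sigma f g p q n :
  (rho + sigma + n%:R) * moment rho sigma f g p q n
  = moment rho sigma f g p.+1 q n + moment rho sigma f g p q.+1 n.
Proof.
rewrite /moment mulr_sumr -big_split /=; apply: eq_bigr => i _.
have -> : n%:R = i%:R + (n - i)%N%:R :> K by rewrite -natrD subnKC // -ltnS.
by rewrite !exprS; ring.
Qed.

(** The coefficientwise form of the equation for [t^rho f], multiplied by
    [theta^q (t^sigma g)].  The term of index [0] on the left vanishes because
    [rho] is an exponent at the origin. *)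
Lemma moment_ode_l a b c rho sigma f g q n :
    frobenius_sol a b c rho f ->
  moment rho sigma f g 2 q n.+1 + (c - 1) * moment rho sigma f g 1 q n.+1
  = moment rho sigma f g 2 q n + (a + b) * moment rho sigma f g 1 q n
    + a * b * moment rho sigma f g 0 q n.
Proof.
move=> [rho_exp rec]; rewrite /moment !mulr_sumr -!big_split /= big_ord_recl /=.
set t0 := (X in X + _ = _).
have -> : t0 = rho * (rho + c - 1) * ((sigma + n.+1%:R) ^+ q * (f 0%N * g n.+1)).
  by rewrite /t0 subn0; ring.
rewrite rho_exp mul0r add0r; apply: eq_bigr => i _.
rewrite /bump /= add1n subSS.
set s := (_ ^+ q); set h := g _.
transitivity ((rho + i.+1%:R) * (rho + i.+1%:R + c - 1) * f i.+1 * (s * h)).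
  by ring.
by rewrite rec; ring.
Qed.

Lemma moment_ode_r a b c rho sigma f g p n :
    frobenius_sol a b c sigma g ->
  moment rho sigma f g p 2 n.+1 + (c - 1) * moment rho sigma f g p 1 n.+1
  = moment rho sigma f g p 2 n + (a + b) * moment rho sigma f g p 1 n
    + a * b * moment rho sigma f g p 0 n.
Proof. by move=> ?; rewrite !(moment_sym rho); apply: moment_ode_l. Qed.

Lemma fps_mul_moment f g n : fps_mul f g n = moment 0 0 f g 0 0 n.
Proof. by apply: eq_bigr => i _; rewrite !expr0 !mul1r. Qed.

Lemma fps_mul_scaleX2 (k : K) f n :
  fps_mul (fps_of_poly (k *: 'X^2)) f n = if n is m.+2 then k * f m else 0.
Proof.
rewrite /fps_mul /fps_of_poly.
case: n => [|[|n]]; rewrite ?big_ord_recl ?big_ord0 /=;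
  rewrite !coefZ !coefXn ?subn0 /= ?mulr0 ?mul0r ?addr0 //.
rewrite mulr1 !add0r /bump /= !add1n !subSS subn0 big1 ?addr0 // => i _.
by rewrite coefZ coefXn /= mulr0 mul0r.
Qed.

End Moments.

(** * The linear system satisfied by products of solutions *)

Section ProductSystem.
Set Implicit Arguments.
Unset Strict Implicit.
Variable K : numFieldType.
Implicit Types (a b c : K) (M : nat -> nat -> nat -> K).

(** [M m p q] stands for the coefficient of [t^(m+2)] in a combination of
    functions [theta^p(y) * theta^q(z)], with [y] and [z] solutions of
    [E(a,b,c)] and [E(a',b',-c)].  Indexing from [t^2] on lets the product of
    the solutions of exponents [1-c] and [1+c] start at [m = 0]. *)
Record product_system a b a' b' c M : Prop := ProductSystem {
  ps_leibniz : forall m p q, m.+2%:R * M m p q = M m p.+1 q + M m p q.+1;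
  ps_ode_l : forall m q, M m.+1 2%N q + (c - 1) * M m.+1 1%N q
                         = M m 2%N q + (a + b) * M m 1%N q + a * b * M m 0%N q;
  ps_ode_r : forall m p, M m.+1 p 2%N + (- c - 1) * M m.+1 p 1%N
                         = M m p 2%N + (a' + b') * M m p 1%N + a' * b' * M m p 0%N
}.

Definition source_l a b M m q : K :=
  M m 2%N q + (a + b) * M m 1%N q + a * b * M m 0%N q.
Definition source_r a' b' M m p : K :=
  M m p 2%N + (a' + b') * M m p 1%N + a' * b' * M m p 0%N.

(** Under this condition the coefficients of [t^(m+2)] contribute nothing to the
    four moments [M m.+1 p q] with [p, q <= 1].  The sources of index 1 enter
    only through their sum: in [product_system_hyp] below, [theta^2(y) theta(z)]
    and [theta(y) theta^2(z)] have poles at [t = 1] that cancel each other, so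
    separately these sources need not vanish. *)
Definition no_source a b a' b' M m : Prop :=
  [/\ source_l a b M m 0 = 0, source_r a' b' M m 0 = 0
    & source_l a b M m 1 + source_r a' b' M m 1 = 0].

(** With [N = m + 3] and zero sources, the system is triangular in
    [s = M 1 1], [w = M 1 0], [v = M 0 1], [u = M 0 0], namely [(N - 2) s = 0],
    [(N + c - 1) w = s], [(N - c - 1) v = s], [N u = v + w]. *)
Lemma product_systemS a b a' b' c M m :
    (forall k : int, c <> k%:~R) -> product_system a b a' b' c M ->
    no_source a b a' b' M m ->
  M m.+1 0%N 0%N = 0 /\ no_source a b a' b' M m.+1.
Proof.
move=> c_nonint [leib odel oder] [srcl srcr srcs].
have l0 := odel m 0%N; rewrite -/(source_l a b M m 0) srcl in l0.
have r0 := oder m 0%N; rewrite -/(source_r a' b' M m 0) srcr in r0.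
have L p q := leib m.+1 p q.
have cz k : c - k%:~R != 0 by rewrite subr_eq0; apply/eqP/c_nonint.
have s0 : M m.+1 1%N 1%N = 0.
  have nz : m.+1%:R != 0 :> K by rewrite pnatr_eq0.
  apply: (mulfI nz); rewrite mulr0 -srcs /source_l /source_r -odel -oder.
  transitivity (m.+3%:R * M m.+1 1%N 1%N - 2 * M m.+1 1%N 1%N); first by ring.
  by rewrite L; ring.
have w0 : M m.+1 1%N 0%N = 0.
  have := cz (- (m.+2%:Z)); rewrite rmorphN /= opprK => /mulfI; apply.
  rewrite mulr0.
  transitivity (m.+3%:R * M m.+1 1%N 0%N + (c - 1) * M m.+1 1%N 0%N).
    by rewrite -pmulrn; ring.
  by rewrite L s0 addr0 l0.
have v0 : M m.+1 0%N 1%N = 0.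
  have := cz m.+2%:Z => /mulfI; apply.
  rewrite mulr0 -[RHS]oppr0.
  transitivity (- (m.+3%:R * M m.+1 0%N 1%N + (- c - 1) * M m.+1 0%N 1%N)).
    by rewrite -pmulrn; ring.
  by rewrite L s0 add0r r0.
have u0 : M m.+1 0%N 0%N = 0.
  have nz : m.+3%:R != 0 :> K by rewrite pnatr_eq0.
  by apply: (mulfI nz); rewrite L v0 w0 addr0 mulr0.
rewrite w0 mulr0 addr0 in l0; rewrite v0 mulr0 addr0 in r0.
split=> //; split; rewrite /source_l /source_r ?u0 ?v0 ?w0 ?s0 !mulr0 !addr0 //.
by rewrite -L s0 mulr0.
Qed.

Lemma product_system_eq0 a b a' b' c M m :
    (forall k : int, c <> k%:~R) -> product_system a b a' b' c M ->
    no_source a b a' b' M 0 ->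
  M m.+1 0%N 0%N = 0.
Proof.
move=> c_nonint sysM src0.
suff src : no_source a b a' b' M m by case: (product_systemS c_nonint sysM src).
by elim: m => // m IH; case: (product_systemS c_nonint sysM IH).
Qed.

End ProductSystem.

(** * Hypergeometric series *)

Section Hypergeometric.
Set Implicit Arguments.
Unset Strict Implicit.
Variable K : numFieldType.
Implicit Types (a b c : K).

Lemma pochhammer0 (x : K) : pochhammer x 0 = 1.
Proof. by rewrite /pochhammer big_ord0. Qed.

Lemma pochhammerS (x : K) n : pochhammer x n.+1 = pochhammer x n * (x + n%:R).
Proof. by rewrite /pochhammer big_ord_recr. Qed.

Lemma hyp2F1_0 a b c : hyp2F1 a b c 0 = 1.
Proof. by rewrite /hyp2F1 !pochhammer0 fact0 !mulr1 divr1. Qed.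

Lemma hyp2F1_S a b c n :
  hyp2F1 a b c n.+1
  = (a + n%:R) * (b + n%:R) / (n.+1%:R * (c + n%:R)) * hyp2F1 a b c n.
Proof.
rewrite /hyp2F1 !pochhammerS factS natrM [n.+1%:R * _]mulrC.
rewrite [_ * (_ + _) * _]mulrACA [n`!%:R * _ * _]mulrACA invfM.
by rewrite [LHS]mulrACA mulrC.
Qed.

(** Covers both local solutions at the origin: [rho = 0] with [c0 = c], and
    [rho = 1 - c] with [c0 = 2 - c]. *)
Lemma frobenius_sol_hyp2F1 a b c rho c0 :
    rho * (rho + c - 1) = 0 -> c0 = 2 * rho + c ->
    (forall n : nat, c0 + n%:R != 0) ->
  frobenius_sol a b c rho (hyp2F1 (rho + a) (rho + b) c0).
Proof.
move=> rho_exp c0E c0_nz; split=> // n.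
have n1 : n.+1%:R != 0 :> K by rewrite pnatr_eq0.
have -> : (rho + n.+1%:R) * (rho + n.+1%:R + c - 1) = n.+1%:R * (c0 + n%:R).
  transitivity (rho * (rho + c - 1) + n.+1%:R * (c0 + n%:R)).
    by rewrite c0E; ring.
  by rewrite rho_exp add0r.
rewrite hyp2F1_S; field.
by rewrite c0_nz addrC natr1 n1.
Qed.

(** The multiple of [y2 z2] for which the coefficients of [t^2] in the sum
    satisfy [no_source], see [no_source_hyp]. *)
Definition product_coef a b c : K :=
  a * pochhammer b 3 * (a - c) / (c * pochhammer (c - 1) 3 * (c - b - 1)).

(** The coefficient of [t^(m+2)] in
    [theta^p(y1) * theta^q(z1) + k * theta^p(y2) * theta^q(z2)].  The second
    product starts at [t^2], so its coefficient has index [m]. *)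
Definition hyp_moment a b c (m p q : nat) : K :=
  moment 0 0 (hyp2F1 a b c) (hyp2F1 (- a) (- b - 2) (- c)) p q m.+2
  + product_coef a b c
    * moment (1 - c) (1 + c)
        (hyp2F1 (a - c + 1) (b - c + 1) (2 - c))
        (hyp2F1 (- a + c + 1) (- b + c - 1) (2 + c)) p q m.

Variables a b c : K.
Hypothesis c_nonint : forall k : int, c <> k%:~R.

Lemma nonint_addz (k : int) : c + k%:~R != 0.
Proof. by rewrite addr_eq0 -rmorphN; apply/eqP/c_nonint. Qed.

Lemma nonint_subz (k : int) : - c + k%:~R != 0.
Proof. by rewrite addrC subr_eq0 eq_sym; apply/eqP/c_nonint. Qed.

(** The exponents of the two products add up to [0] and to [2], so the Leibniz
    rule has the same factor [m + 2] for both. *)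
Lemma product_system_hyp :
  product_system a b (- a) (- b - 2) c (hyp_moment a b c).
Proof.
have add_nz n : c + n%:R != 0 by apply: (nonint_addz n).
have sub_nz n : - c + n%:R != 0 by apply: (nonint_subz n).
have y1 : frobenius_sol a b c 0 (hyp2F1 a b c).
  have := @frobenius_sol_hyp2F1 a b c 0 c; rewrite !add0r mul0r mulr0 add0r.
  exact.
have z1 : frobenius_sol (- a) (- b - 2) (- c) 0 (hyp2F1 (- a) (- b - 2) (- c)).
  have := @frobenius_sol_hyp2F1 (- a) (- b - 2) (- c) 0 (- c).
  by rewrite !add0r mul0r mulr0 add0r; apply.
have y2 : frobenius_sol a b c (1 - c) (hyp2F1 (a - c + 1) (b - c + 1) (2 - c)).
  have -> : a - c + 1 = 1 - c + a by ring.
  have -> : b - c + 1 = 1 - c + b by ring.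
  apply: frobenius_sol_hyp2F1 => [||n]; try ring.
  by have := sub_nz n.+2; rewrite -!natr1; congr (_ != _); ring.
have z2 : frobenius_sol (- a) (- b - 2) (- c) (1 + c)
            (hyp2F1 (- a + c + 1) (- b + c - 1) (2 + c)).
  have -> : - a + c + 1 = 1 + c + - a by ring.
  have -> : - b + c - 1 = 1 + c + (- b - 2) by ring.
  apply: frobenius_sol_hyp2F1 => [||n]; try ring.
  by have := add_nz n.+2; rewrite -!natr1; congr (_ != _); ring.
split=> [m p q|m q|m p]; rewrite /hyp_moment.
- have leib1 := moment_leibniz 0 0 (hyp2F1 a b c)
    (hyp2F1 (- a) (- b - 2) (- c)) p q m.+2.
  have leib2 := moment_leibniz (1 - c) (1 + c)
    (hyp2F1 (a - c + 1) (b - c + 1) (2 - c))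
    (hyp2F1 (- a + c + 1) (- b + c - 1) (2 + c)) p q m.
  have e1 : 0 + 0 + m.+2%:R = m.+2%:R :> K by ring.
  have e2 : 1 - c + (1 + c) + m%:R = m.+2%:R :> K by ring.
  rewrite e1 in leib1; rewrite e2 in leib2.
  by rewrite mulrDr mulrCA leib1 leib2 mulrDr addrACA.
- rewrite mulrDr addrACA [(c - 1) * (product_coef _ _ _ * _)]mulrCA -mulrDr.
  by rewrite !(moment_ode_l _ _ _ _ y1) !(moment_ode_l _ _ _ _ y2); ring.
- rewrite mulrDr addrACA [(- c - 1) * (product_coef _ _ _ * _)]mulrCA -mulrDr.
  by rewrite !(moment_ode_r _ _ _ _ z1) !(moment_ode_r _ _ _ _ z2); ring.
Qed.

Hypothesis c_neq : c <> b + 1.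

Lemma denominators_neq0 :
  [&& c != 0, c + 1 != 0, c - 1 != 0, - c + 1 != 0, c - 1 + 2 != 0
    & c - b - 1 != 0].
Proof.
have := nonint_addz 0; rewrite addr0 => ->.
rewrite (nonint_addz 1) (nonint_addz (- 1)) (nonint_subz 1) /=.
have -> : c - 1 + 2 = c + 1 by ring.
rewrite (nonint_addz 1) -addrA -opprD subr_eq0.
exact/eqP.
Qed.

Lemma hyp_moment_0E p q :
  hyp_moment a b c 0 p q
  = 0 ^+ p * 2 ^+ q * (a * (a - 1) * (b + 1) * (b + 2) / (2 * c * (c - 1)))
    - a ^+ 2 * b * (b + 2) / c ^+ 2
    + 2 ^+ p * 0 ^+ q * (a * (a + 1) * b * (b + 1) / (2 * c * (c + 1)))
    + product_coef a b c * (1 - c) ^+ p * (1 + c) ^+ q.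
Proof.
have /and5P[c0 c1 c1' n1 _] := denominators_neq0.
rewrite /hyp_moment; move: (product_coef a b c) => k.
rewrite /moment !big_ord_recl !big_ord0 /= /bump /= !(hyp2F1_S, hyp2F1_0).
rewrite !add1n !(subSS, subn0, addr0, add0r, mul1r, mulr1, expr1n).
rewrite -!addrA; congr (_ + (_ + (_ + _))); last by rewrite mulrA.
all: by field; rewrite ?oppr_eq0 ?c0 ?c1 ?c1' ?n1.
Qed.

Lemma hyp_moment_0 :
  hyp_moment a b c 0 0 0 = a * (a - b - 1) / (c * (c - b - 1)).
Proof.
have /and5P[c0 c1 c1' n1 /andP[c2 cb]] := denominators_neq0.
rewrite hyp_moment_0E /product_coef !pochhammerS !pochhammer0 addr0 subrK.
by field; rewrite ?c0 ?c1 ?c1' ?c2 ?cb.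
Qed.

(** The system has the same shape for arbitrary parameters in place of [- a] and
    [- b - 2].  It is these particular values, together with that of
    [product_coef], that make the recursion stop after [t^2]. *)
Lemma no_source_hyp : no_source a b (- a) (- b - 2) (hyp_moment a b c) 0.
Proof.
have /and5P[c0 c1 c1' n1 /andP[c2 cb]] := denominators_neq0.
split; rewrite /source_l /source_r !hyp_moment_0E /product_coef;
  rewrite !pochhammerS !pochhammer0 addr0 subrK.
all: by field; rewrite ?c0 ?c1 ?c1' ?c2 ?cb.
Qed.

Lemma hyp_moment_eq0 m : hyp_moment a b c m.+1 0 0 = 0.
Proof.
exact: product_system_eq0 c_nonint product_system_hyp no_source_hyp.
Qed.

End Hypergeometric.

Theorem lemma3p4 (R : realType) (a b c : R[i])
    (c_nonint : forall m : int, c <> m%:~R) (c_neq : c <> b + 1) :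
  (hyp2F1 a b c * hyp2F1 (- a) (- b - 2) (- c)
   + fps_of_poly ((a * pochhammer b 3 * (a - c)
                   / (c * pochhammer (c - 1) 3 * (c - b - 1))) *: 'X^2)
     * (hyp2F1 (a - c + 1) (b - c + 1) (2 - c)
        * hyp2F1 (- a + c + 1) (- b + c - 1) (2 + c)))%fps
  =1 fps_of_poly (1 - (2 * a / c) *: 'X
                  + (a * (a - b - 1) / (c * (c - b - 1))) *: 'X^2).
Proof.
have coefE n : (fps_of_poly (1 - (2 * a / c) *: 'X
                  + (a * (a - b - 1) / (c * (c - b - 1))) *: 'X^2)) n
  = match n with
    | 0 => 1 | 1 => - (2 * a / c)
    | 2 => a * (a - b - 1) / (c * (c - b - 1)) | _ => 0 end.
  rewrite /fps_of_poly !(coefD, coefN, coefZ, coef1, coefX, coefXn).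
  by case: n => [|[|[|n]]] /=;
    rewrite ?(mulr0, mulr1, oppr0, addr0, subr0, add0r, sub0r).
have c0 : c != 0 by have := nonint_addz c_nonint 0; rewrite addr0.
move=> n; rewrite coefE /fps_add fps_mul_scaleX2.
case: n => [|[|m]].
- by rewrite addr0 /fps_mul big_ord1 !hyp2F1_0 mulr1.
- rewrite addr0 /fps_mul !big_ord_recl big_ord0 /= !hyp2F1_S !hyp2F1_0.
  rewrite !addr0 mul1r !mulr1; field.
  exact: c0.
(* From [t^2] on, the left-hand side is the moment with [p = q = 0]; the shifts
   [1 - c] and [1 + c] then only appear with exponent 0. *)
rewrite !fps_mul_moment -[LHS]/(hyp_moment a b c m 0 0).
case: m => [|m]; first exact: hyp_moment_0.
exact: hyp_moment_eq0.
Qed.
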